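(* If $\mathbf{Z}\sim LCFUSN_{n,m}(\boldsymbol{\mu},\boldsymbol{\Sigma},\boldsymbol{\Delta})$, then the entropy of $\mathbf{Z}$ is $$H_{LCFUSN_{n,m}(\boldsymbol{\mu},\boldsymbol{\Sigma},\boldsymbol{\Delta})}=H_{CFUSN_{n,m}(\boldsymbol{\mu},\boldsymbol{\Sigma},\boldsymbol{\Delta})}+\sum_{i=1}^nE(X_i),$$ where $X_i$ is the $i$th component of a random vector $\mathbf{X}\sim CFUSN_{n,m}(\boldsymbol{\mu},\boldsymbol{\Sigma},\boldsymbol{\Delta})$ and $H_{CFUSN_{n,m}(\boldsymbol{\mu},\boldsymbol{\Sigma},\boldsymbol{\Delta})}$ is the entropy of $\mathbf{X}$.
   Context: The (Shannon, differential) entropy of a continuous random vector $\mathbf{Z}$ with density $f_{\mathbf{Z}}$ is $H_{\mathbf{Z}}=-E[\ln f_{\mathbf{Z}}(\mathbf{Z})]$; $H_D$ denotes the entropy of a random vector with distribution $D$. Notation: a prime denotes transpose; $|\mathbf{A}|=\det\mathbf{A}$; $\phi_n$ is the density of $N_n(\mathbf{0},\mathbf{I}_n)$; $\Phi_m(\cdot\mid\mathbf{S})$ is the cumulative distribution function of $N_m(\mathbf{0},\mathbf{S})$; $\|\cdot\|$ is the Euclidean norm; $\exp$ and $\ln$ of vectors are taken componentwise. Let $n,m\ge1$, let $\boldsymbol{\Delta}$ be a real $n\times m$ matrix (skewness matrix) with $\|\boldsymbol{\Delta}\mathbf{a}\|<1$ for all unit vectors $\mathbf{a}\in\mathbb{R}^m$,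 let $\boldsymbol{\mu}\in\mathbb{R}^n$, and let $\boldsymbol{\Sigma}$ be a positive definite $n\times n$ matrix with symmetric positive definite square root $\boldsymbol{\Sigma}^{1/2}$. Canonical fundamental skew-normal distribution: $\mathbf{W}\sim CFUSN_{n,m}(\boldsymbol{\mu},\boldsymbol{\Sigma},\boldsymbol{\Delta})$ means that $\mathbf{W}$ has density $$f_{\mathbf{W}}(\mathbf{w})=2^m|\boldsymbol{\Sigma}|^{-1/2}\phi_n(\boldsymbol{\Sigma}^{-1/2}(\mathbf{w}-\boldsymbol{\mu}))\,\Phi_m(\boldsymbol{\Delta}'\boldsymbol{\Sigma}^{-1/2}(\mathbf{w}-\boldsymbol{\mu})\mid\mathbf{I}_m-\boldsymbol{\Delta}'\boldsymbol{\Delta}),\quad\mathbf{w}\in\mathbb{R}^n.$$ Log-canonical fundamental skew-normal distribution: $\mathbf{U}\sim LCFUSN_{n,m}(\boldsymbol{\mu},\boldsymbol{\Sigma},\boldsymbol{\Delta})$ means that $\mathbf{U}=\exp(\mathbf{W})$ with $\mathbf{W}\sim CFUSN_{n,m}(\boldsymbol{\mu},\boldsymbol{\Sigma},\boldsymbol{\Delta})$; equivalently, $\mathbf{U}$ has density, for $\mathbf{u}\in(0,\infty)^n$, $$f_{\mathbf{U}}(\mathbf{u})=\frac{2^m|\boldsymbol{\Sigma}|^{-1/2}}{\prod_{j=1}^nu_j}\,\phi_n(\boldsymbol{\Sigma}^{-1/2}(\ln\mathbf{u}-\boldsymbol{\mu}))\,\Phi_m(\boldsymbol{\Delta}'\boldsymbol{\Sigma}^{-1/2}(\ln\mathbf{u}-\boldsymbol{\mu})\mid\mathbf{I}_m-\boldsymbol{\Delta}'\boldsymbol{\Delta}).$$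 *)

(* Defs.v *)
From HB Require Import structures.
From mathcomp Require Import all_boot all_order all_algebra.
From mathcomp Require Import all_classical all_reals all_analysis.

Set Implicit Arguments.
Unset Strict Implicit.
Unset Printing Implicit Defensive.

Import Order.TTheory GRing.Theory Num.Theory.
Import numFieldNormedType.Exports.

Local Open Scope classical_set_scope.
Local Open Scope ring_scope.
Local Open Scope charge_scope.

(* Random vectors take values in [n.-tuple R], which carries the product of the
   Borel sigma-algebras; matrix algebra is done on column vectors. *)
Definition tcol (R : Type) (n : nat) (t : n.-tuple R) : 'cV[R]_n :=
  \col_i tnth t i.

Section lebesgue_measure_tuple.
Context {R : realType}.
Local Open Scope ereal_scope.

Let consp (n : nat) (p : R * n.-tuple R) : n.+1.-tuple R :=
  [tuple of p.1 :: p.2].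

Let measurable_consp n : measurable_fun [set: R * n.-tuple R] (@consp n).
Proof.
by apply: measurable_cons; [exact: measurable_fst|exact: measurable_snd].
Qed.

Section cons_step.
Variables (n : nat) (nu : {sigma_finite_measure set (n.-tuple R) -> \bar R}).

Definition lebesgue_cons : set (n.+1.-tuple R) -> \bar R :=
  pushforward (lebesgue_measure \x nu) (@consp n).

Let preimage_consp A : measurable A -> measurable (@consp n @^-1` A).
Proof.
by move=> mA; rewrite -[X in measurable X]setTI; exact: measurable_consp.
Qed.

Let lebesgue_cons0 : lebesgue_cons set0 = 0.
Proof. by rewrite /lebesgue_cons /pushforward preimage_set0 measure0. Qed.

Let lebesgue_cons_ge0 A : 0 <= lebesgue_cons A.
Proof. exact: (measure_ge0 (lebesgue_measure \x nu)). Qed.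

Let lebesgue_cons_sigma_additive : semi_sigma_additive lebesgue_cons.
Proof.
move=> F mF tF mUF; rewrite /lebesgue_cons /pushforward preimage_bigcup.
apply: measure_semi_sigma_additive.
- by move=> k; exact: preimage_consp.
- apply/trivIsetP => /= i j _ _ ij; rewrite -preimage_setI.
  by move/trivIsetP : tF => /(_ _ _ _ _ ij) ->//; rewrite preimage_set0.
- by rewrite -preimage_bigcup; exact: preimage_consp.
Qed.

HB.instance Definition _ := isMeasure.Build _ _ _ lebesgue_cons
  lebesgue_cons0 lebesgue_cons_ge0 lebesgue_cons_sigma_additive.

Lemma measurable_thead : measurable_fun [set: n.+1.-tuple R] (@thead n R).
Proof. exact: measurable_tnth. Qed.

Lemma lebesgue_consE (A : set R) (B : set (n.-tuple R)) :
  measurable A -> measurable B ->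
  lebesgue_cons [set t | A (thead t) /\ B [tuple of behead t]] =
  lebesgue_measure A * nu B.
Proof.
move=> mA mB; rewrite -product_measure1E// /lebesgue_cons /pushforward.
congr ((_ \x _) _); apply/seteqP; split=> -[x t] /=.
  move=> [Ax Bt]; split=> //=.
  by rewrite (_ : t = [tuple of behead (consp (x, t))])//; exact/val_inj.
move=> [Ax Bt]; split=> //=.
by rewrite (_ : [tuple of behead (consp (x, t))] = t)//; exact/val_inj.
Qed.

Let lebesgue_cons_sigma_finite : sigma_finite setT lebesgue_cons.
Proof.
have /sigma_finiteP[F [TF ndF Foo]] := sigma_finiteT (@lebesgue_measure R).
have /sigma_finiteP[G [TG ndG Goo]] := sigma_finiteT nu.
exists (fun k => [set t | F k (thead t) /\ G k [tuple of behead t]]).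
  apply/esym/seteqP; split=> // t _.
  have : setT (thead t) by []. rewrite TF => -[i _ Fi].
  have : setT [tuple of behead t] by []. rewrite TG => -[j _ Gj].
  exists (maxn i j) => //; split.
  - by move: Fi; exact/subsetPset/ndF/leq_maxl.
  - by move: Gj; exact/subsetPset/ndG/leq_maxr.
move=> k; have [mF Fk] := Foo k; have [mG Gk] := Goo k; split.
  have -> : [set t | F k (thead t) /\ G k [tuple of behead t]] =
     (@thead n R @^-1` F k) `&`
     ((fun t : n.+1.-tuple R => [tuple of behead t]) @^-1` G k) by [].
  apply: measurableI; rewrite -[X in measurable X]setTI.
    exact: measurable_thead.
  exact: measurable_behead.
by rewrite lebesgue_consE// lte_mul_pinfty// ge0_fin_numE.
Qed.

HB.instance Definition _ := Measure_isSigmaFinite.Build _ _ _ lebesgue_cons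
  lebesgue_cons_sigma_finite.

End cons_step.

(* n-dimensional Lebesgue measure, as an iterated product; [lebesgue_tuple_box]
   below gives its value on boxes. *)
Fixpoint lebesgue_tuple (n : nat) :
    {sigma_finite_measure set (n.-tuple R) -> \bar R} :=
  match n with
  | 0 => \d_([tuple] : 0.-tuple R)
  | k.+1 => lebesgue_cons (lebesgue_tuple k)
  end.

Lemma measurable_box n (A : 'I_n -> set R) :
  (forall i, measurable (A i)) ->
  measurable [set t : n.-tuple R | forall i, A i (tnth t i)].
Proof.
move=> mA.
have -> : [set t : n.-tuple R | forall i, A i (tnth t i)] =
    \bigcap_(i in [set: 'I_n]) ((fun t : n.-tuple R => tnth t i) @^-1` A i).
  by apply/seteqP; split=> t /= At i; [move=> _; exact: At|exact: (At i I)].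
apply: fin_bigcap_measurable => [|i _]; first exact: finite_finset.
by rewrite -[X in measurable X]setTI; exact: measurable_tnth.
Qed.

Lemma lebesgue_tuple_box n (A : 'I_n -> set R) :
  (forall i, measurable (A i)) ->
  lebesgue_tuple n [set t | forall i, A i (tnth t i)] =
  \prod_(i < n) lebesgue_measure (A i).
Proof.
elim: n A => [|n IHn] A mA.
  rewrite big_ord0 /= /dirac/= indicE mem_set//.
  by move=> [].
have mB := measurable_box (fun i => mA (lift ord0 i)).
rewrite big_ord_recl -IHn // -(lebesgue_consE _ (mA ord0) mB).
have inordS (i : 'I_n) : inord i.+1 = lift ord0 i.
  by apply/val_inj; rewrite /= inordK ?ltnS.
congr (lebesgue_cons _ _); apply/seteqP; split=> t /=.
  by move=> At; split=> [|i]; [exact: At|rewrite tnth_behead inordS; exact: At].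
move=> [A0 At] i; have [j ->|->] := unliftP ord0 i; last exact: A0.
by have := At j; rewrite tnth_behead inordS.
Qed.

End lebesgue_measure_tuple.

Definition has_density (R : realType) (d : measure_display)
    (T : measurableType d) (P : probability T R) (n : nat)
    (X : {RV P >-> n.-tuple R}) (f : n.-tuple R -> R) : Prop :=
  [/\ measurable_fun [set: n.-tuple R] f, (forall x, 0 <= f x) &
   forall A, measurable A ->
     distribution P X A = (\int[lebesgue_tuple n]_(x in A) (f x)%:E)%E].
Arguments has_density {R d T} P {n} X f.

(* The Radon-Nikodym derivative of the law of X; it is determined only almost
   everywhere, which is enough for the expectation in [entropy]. *)
Definition density (R : realType) (d : measure_display)
    (T : measurableType d) (P : probability T R) (n : nat)
    (X : {RV P >-> n.-tuple R}) (x : n.-tuple R) : R :=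
  fine (('d (charge_of_finite_measure (distribution P X))
         '/d (lebesgue_tuple n)) x).
Arguments density {R d T} P {n} X x.

Definition entropy (R : realType) (d : measure_display)
    (T : measurableType d) (P : probability T R) (n : nat)
    (X : {RV P >-> n.-tuple R}) : \bar R :=
  (- 'E_P[fun w => ln (density P X (X w))])%E.
Arguments entropy {R d T} P {n} X.

Definition posdefmx (R : realType) (n : nat) (A : 'M[R]_n) : Prop :=
  A^T = A /\
  forall x : 'cV[R]_n, x != 0 -> 0 < (x^T *m A *m x) ord0 ord0.

Definition enorm (R : realType) (n : nat) (x : 'cV[R]_n) : R :=
  Num.sqrt (\sum_i x i ord0 ^+ 2).

Definition mvnormal_pdf (R : realType) (n : nat) (S : 'M[R]_n)
    (x : 'cV[R]_n) : R :=
  (Num.sqrt ((2 * pi) ^+ n * \det S))^-1 *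
  expR (- (x^T *m invmx S *m x) ord0 ord0 / 2).

Definition mvnormal_cdf (R : realType) (n : nat) (S : 'M[R]_n)
    (y : 'cV[R]_n) : R :=
  \int[lebesgue_tuple n]_(t in [set t | forall i, tnth t i <= y i ord0])
    mvnormal_pdf S (tcol t).

(* [Sh] is meant to be the symmetric positive definite square root of [Sigma]. *)
Definition cfusn_pdf (R : realType) (n m : nat) (mu : 'cV[R]_n)
    (Sigma Sh : 'M[R]_n) (Delta : 'M[R]_(n, m)) (w : n.-tuple R) : R :=
  let z := invmx Sh *m (tcol w - mu) in
  2 ^+ m * (Num.sqrt (\det Sigma))^-1 * mvnormal_pdf 1%:M z *
  mvnormal_cdf (1%:M - Delta^T *m Delta) (Delta^T *m z).

Definition cfusn (R : realType) (d : measure_display)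
    (T : measurableType d) (P : probability T R) (n m : nat)
    (W : {RV P >-> n.-tuple R}) (mu : 'cV[R]_n)
    (Sigma Sh : 'M[R]_n) (Delta : 'M[R]_(n, m)) : Prop :=
  has_density P W (cfusn_pdf mu Sigma Sh Delta).
Arguments cfusn {R d T} P {n m} W mu Sigma Sh Delta.

(* The identity U = exp W is required almost surely, so that the property
   depends on the law of U only. *)
Definition lcfusn (R : realType) (d : measure_display)
    (T : measurableType d) (P : probability T R) (n m : nat)
    (U : {RV P >-> n.-tuple R}) (mu : 'cV[R]_n)
    (Sigma Sh : 'M[R]_n) (Delta : 'M[R]_(n, m)) : Prop :=
  exists W : {RV P >-> n.-tuple R},
    cfusn P W mu Sigma Sh Delta /\
    {ae P, forall w, U w = map_tuple expR (W w)}.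
Arguments lcfusn {R d T} P {n m} U mu Sigma Sh Delta.

(* Main.v *)
Require Import Defs.
From HB Require Import structures.
From mathcomp Require Import all_boot all_order all_algebra.
From mathcomp Require Import all_classical all_reals all_analysis.
From mathcomp Require Import measurable_realfun ring lra.

Set Implicit Arguments.
Unset Strict Implicit.
Unset Printing Implicit Defensive.

Import Order.TTheory GRing.Theory Num.Theory.
Import numFieldNormedType.Exports.

Local Open Scope classical_set_scope.
Local Open Scope ring_scope.

(** Write Z = exp W with W of density f.  Changing variables coordinatewise, Z
    has density g(u) = f(ln u) / (u_1 ... u_n) on the positive orthant, so that

      ln g(Z) = ln f(W) - (W_1 + ... + W_n)   almost surely,

    and the entropy formula follows by taking expectations.  Since the
    expectations involved depend only on the law of W, W may be traded for X.

    Three points need care.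
    - The entropy is defined from a Radon-Nikodym derivative, which equals any
      other density of the law only almost everywhere; [ae_density] transports
      this equality along the random vector, and [entropyE] lets one compute
      the entropy from any density.
    - The change of variables is proved in dimension one by comparing measures
      on intervals ([ge0_integral_expR]) and in dimension n by Tonelli's theorem
      ([ge0_integral_map_expR]).
    - The expectation of ln f(W) may a priori be infinite, or of the form
      oo - oo.  The expectation of ln f(W) - (W_1 + ... + W_n) nevertheless
      splits because the W_i are integrable ([integralD_integrabler]).  Indeed
      a CFUSN density lies below a multiple of a Gaussian function
      ([cfusn_pdf_le_gauss]): writing D for the skewness matrix, the
      distribution function of N(0, I - D'D) is bounded, since D being a strict
      contraction gives t' (I - D'D)^-1 t >= |t|^2 ([contraction_inv_ge]). *)

(** * Measures with a density *)

Section density_measure.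
Context d (T : measurableType d) (R : realType).
Variables (mu : {measure set T -> \bar R}) (k : T -> R).
Hypotheses (mk : measurable_fun [set: T] k) (k0 : forall x, 0 <= k x).
Local Open Scope ereal_scope.

Import HBNNSimple.

(** By the hypothesis on nu this holds for indicators, hence for nonnegative
    simple functions; approximating h from below by simple functions, monotone
    convergence on both sides gives the general case. *)
Lemma ge0_integral_density (nu : {measure set T -> \bar R}) (h : T -> \bar R) :
  (forall A, measurable A -> nu A = \int[mu]_(x in A) (k x)%:E) ->
  measurable_fun [set: T] h -> (forall x, 0 <= h x) ->
  \int[nu]_x h x = \int[mu]_x (h x * (k x)%:E).
Proof.
move=> nuE mh h0.
have mkE : measurable_fun [set: T] (EFin \o k) by exact/measurable_EFinP.
pose g := nnsfun_approx measurableT mh.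
have gh x : (g n x)%:E @[n --> \oo] --> h x.
  by apply: cvg_nnsfun_approx => // y _; exact: h0.
have gnd x : {homo (fun n => (g n x)%:E) : a b / (a <= b)%N >-> a <= b}.
  by move=> a b ab; rewrite lee_fin; exact/lefP/nd_nnsfun_approx.
have mg n : measurable_fun [set: T] (fun x => (g n x)%:E).
  exact/measurable_EFinP.
have -> : \int[nu]_x h x = limn (fun n => \int[nu]_x (g n x)%:E).
  rewrite -monotone_convergence//.
  - by apply: eq_integral => x _; apply/esym/cvg_lim.
  - by move=> n x _; rewrite lee_fin.
have -> : \int[mu]_x (h x * (k x)%:E) =
    limn (fun n => \int[mu]_x ((g n x)%:E * (k x)%:E)).
  rewrite -monotone_convergence//.
  - apply: eq_integral => x _; apply/esym/cvg_lim => //.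
    exact: cvgeZr.
  - by move=> n; exact: emeasurable_funM.
  - by move=> n x _; rewrite mule_ge0// lee_fin.
  - move=> x _ a b ab; rewrite lee_wpmul2r// ?lee_fin//.
    exact/lefP/nd_nnsfun_approx.
suff step n : \int[nu]_x (g n x)%:E = \int[mu]_x ((g n x)%:E * (k x)%:E).
  by under eq_fun do rewrite step.
have mind r :
    measurable_fun [set: T] (fun x => (r * \1_(g n @^-1` [set r]) x)%:E).
  by apply/measurable_EFinP; exact: measurable_funM.
have ind0 r x : 0 <= (r * \1_(g n @^-1` [set r]) x)%:E.
  by rewrite EFinM nnfun_muleindic_ge0.
transitivity (\int[nu]_x
    (\sum_(r \in range (g n)) (r * \1_(g n @^-1` [set r]) x)%:E)).
  by apply: eq_integral => x _; rewrite fsumEFin// -fimfunE.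
rewrite ge0_integral_fsum//.
transitivity (\int[mu]_x
    (\sum_(r \in range (g n)) (r * \1_(g n @^-1` [set r]) x)%:E * (k x)%:E)).
  rewrite ge0_integral_fsum//; last 2 first.
  - by move=> r; exact: emeasurable_funM.
  - by move=> r x _; rewrite mule_ge0 ?ind0// lee_fin.
  apply: eq_fsbigr => r; rewrite inE => -[t _ <-].
  under [RHS]eq_integral do rewrite EFinM -muleA.
  under [LHS]eq_integral do rewrite EFinM.
  have m1 : measurable_fun [set: T]
      (fun x => (\1_(g n @^-1` [set g n t]) x : R)%:E).
    exact/measurable_EFinP.
  rewrite !ge0_integralZl ?lee_fin//; last 2 first.
  - exact: emeasurable_funM.
  - by move=> x _; rewrite mule_ge0// lee_fin.
  congr (_ * _); rewrite integral_indic// setIT nuE// integral_mkcond.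
  apply: eq_integral => x _; rewrite patchE indicE /=.
  by case: ifPn => _; rewrite ?mul1e ?mul0e.
apply: eq_integral => x _.
rewrite -ge0_mule_fsuml//.
by rewrite fsumEFin// -fimfunE.
Qed.

Lemma density_measure_exists : exists nu : {measure set T -> \bar R},
  forall A, nu A = \int[mu]_(x in A) (k x)%:E.
Proof.
pose nu A := \int[mu]_(x in A) (k x)%:E.
have nu0 : nu set0 = 0 by exact: integral_set0.
have nu_ge0 A : 0 <= nu A by apply: integral_ge0 => x _; rewrite lee_fin.
have nu_add : semi_sigma_additive nu.
  move=> F mF tF mUF; rewrite /nu ge0_integral_bigcup//=.
  - by apply: is_cvg_ereal_nneg_natsum => n _; exact: nu_ge0.
  - exact/measurable_EFinP/(measurable_funS measurableT).
  - by move=> x _; rewrite lee_fin.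
pose m : {measure set T -> \bar R} :=
  HB.pack nu (isMeasure.Build _ _ _ nu nu0 nu_ge0 nu_add).
by exists m.
Qed.

End density_measure.

(** * The exponential change of variables on the line *)

Lemma integral_expR_Nyln (R : realType) (b : R) : 0 < b ->
  (\int[lebesgue_measure]_(x in `]-oo, ln b]) (expR x)%:E = b%:E)%E.
Proof.
move=> b0; have cE : continuous (@expR R \o -%R).
  move=> x; apply: continuous_comp; first exact: opp_continuous.
  exact: continuous_expR.
have dE (x : R) : is_derive x 1 (- (@expR R \o -%R)) (expR (- x)).
  by apply: is_derive_eq; rewrite mulrN1 opprK.
rewrite -[ln b]opprK ge0_integration_by_substitutionNy; last 2 first.
- exact/continuous_subspaceT/continuous_expR.
- by move=> x _; exact: expR_ge0.
rewrite (@ge0_continuous_FTC2y _ _ (- (@expR R \o -%R)) _ 0)/=.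
- by rewrite !fctE/= !opprK lnK// add0e.
- by move=> x _; exact: expR_ge0.
- exact/continuous_subspaceT.
- by rewrite -oppr0; apply: cvgN; exact: cvgr_expR.
- by move=> x _; exact: (@ex_derive _ _ _ _ _ _ _ (dE x)).
- by apply: cvg_at_right_filter; apply: cvgN; exact: cE.
- by move=> x _; rewrite derive1E; exact: (@derive_val _ _ _ _ _ _ _ (dE x)).
Qed.

(** Let nu be the image by exp of the measure e^x dx.  The claim is that nu is
    the Lebesgue measure of the positive half-line.  Adding to nu the Lebesgue
    measure of the negative half-line gives a measure on the whole line, which
    is the Lebesgue measure as soon as every interval ]a, b] has measure b - a;
    and the mass of ]a, b] for nu is a difference of masses of half-lines. *)
Lemma ge0_integral_expR (R : realType) (h : R -> \bar R) :
  measurable_fun [set: R] h -> (forall x, 0 <= h x)%E ->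
  (\int[lebesgue_measure]_(x in `]0%R, +oo[) h x =
   \int[lebesgue_measure]_x (h (expR x) * (expR x)%:E))%E.
Proof.
move=> mh h0.
have [nu0 nu0E] := @density_measure_exists _ _ _ (@lebesgue_measure R) _
  (@measurable_expR R) (fun x => expR_ge0 x).
have mexp : measurable_fun [set: measurableTypeR R]
    (@expR R : measurableTypeR R -> measurableTypeR R).
  exact: measurable_expR.
(* The measure structure of a pushforward takes the measurability of the map as
   an argument, so it is named explicitly. *)
pose nu : {measure set (measurableTypeR R) -> \bar R} :=
  measure_function_pushforward__canonical__measure_function_Measure nu0 mexp.
have nuE A : nu A = (\int[lebesgue_measure]_(x in expR @^-1` A) (expR x)%:E)%E.
  exact: nu0E.
have nuNy (b : R) : (nu `]-oo, b]%classic = (Num.max b 0)%:E)%E.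
  rewrite nuE; have [b0|b0] := ltP 0 b.
    rewrite -[RHS]integral_expR_Nyln//; congr (integral _ _ _).
    apply/seteqP; split => x /=; rewrite !in_itv/=.
      by rewrite -{1}(lnK b0) ler_expR.
    by rewrite -{2}(lnK b0) ler_expR.
  rewrite (_ : _ @^-1` _ = set0) ?integral_set0//.
  apply/seteqP; split => x //=; rewrite in_itv/= => /le_trans/(_ b0).
  by rewrite leNgt expR_gt0.
have mN : measurable (`]-oo, 0]%classic : set R) by [].
pose neg : {measure set (measurableTypeR R) -> \bar R} :=
  mrestr (@lebesgue_measure R) mN.
pose m : {measure set (measurableTypeR R) -> \bar R} := measure_add nu neg.
have mE A : m A = (nu A + neg A)%E by exact: measure_addE.
have negE A : neg A = lebesgue_measure (A `&` `]-oo, 0]) by [].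
have lebE : forall A, measurable A -> lebesgue_measure A = m A.
  apply: lebesgue_measure_unique => _ [[a b] _ <-].
  rewrite mE negE [(a, b).1]/= [(a, b).2]/=.
  have [ab|ba] := ltP a b; last first.
    by rewrite set_itv_ge ?bnd_simp -?leNgt// set0I !measure0 adde0.
  have nuab : (nu `]-oo, a]%classic + nu `]a, b]%classic = nu `]-oo, b]%classic)%E.
    rewrite -measureU//.
    - congr (nu _); rewrite [RHS](@itv_bndbnd_setU _ _ _ (BRight a))//.
      by rewrite bnd_simp ltW.
    - apply/seteqP; split => x //=; rewrite !in_itv/= => -[xa /andP[]].
      by rewrite ltNge xa.
  rewrite !nuNy in nuab.
  have -> : (nu `]a, b]%classic = (Num.max b 0 - Num.max a 0)%:E)%E.
    move: nuab; case: (nu _) => //= r; rewrite -EFinD => -[<-].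
    by rewrite [in RHS]addrC addKr.
  have -> : `]a, b]%classic `&` `]-oo, 0]%classic = `]a, Num.min b 0]%classic :> set R.
    apply/seteqP; split => x /=; rewrite !in_itv/= le_min.
      by move=> [/andP[-> ->] ->].
    by move=> /and3P[-> -> ->].
  rewrite !lebesgue_measure_itv/= !lte_fin ab lt_min ab/= -EFinB.
  have [a0|a0] := ltP a 0; rewrite ?adde0 -?EFinD; congr EFin.
    by have [?|?] := ltP 0 b; rewrite ?subr0 ?add0r.
  by rewrite max_l// (le_trans a0)// ltW.
have nu_leb (A : set (measurableTypeR R)) : measurable A ->
    A `<=` `]0%R, +oo[ -> nu A = lebesgue_measure A.
  move=> mA A0; rewrite lebE// mE negE.
  rewrite (_ : A `&` _ = set0) ?measure0 ?adde0//.
  apply/seteqP; split => x //= -[/A0 /=]; rewrite !in_itv/= andbT.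
  by move=> /lt_geF ->.
transitivity (\int[nu]_(x in `]0%R, +oo[) h x)%E.
  by apply: eq_measure_integral => A mA A0; rewrite nu_leb.
rewrite ge0_integral_pushforward//=.
rewrite (_ : _ @^-1` _ = setT).
  rewrite (@ge0_integral_density _ _ _ (@lebesgue_measure R) expR)//.
  by apply: measurableT_comp => //; exact: measurable_expR.
  by apply/seteqP; split => x //= _; rewrite in_itv/= andbT expR_gt0.
exact: measurable_funS mh.
Qed.

(** * Iterated integration on tuples *)

Section lebesgue_tuple_integral.
Context (R : realType).
Local Open Scope ereal_scope.

Lemma measurable_tuple_cons n :
  measurable_fun [set: measurableTypeR R * n.-tuple R]
    (fun p => [tuple of p.1 :: p.2] : n.+1.-tuple R).
Proof.
by apply: measurable_cons; [exact: measurable_fst|exact: measurable_snd].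
Qed.

Lemma ge0_integral_lebesgue_tupleS n (h : n.+1.-tuple R -> \bar R) :
  measurable_fun [set: n.+1.-tuple R] h -> (forall t, 0 <= h t) ->
  \int[lebesgue_tuple n.+1]_t h t =
  \int[lebesgue_measure]_x \int[lebesgue_tuple n]_t h [tuple of x :: t].
Proof.
move=> mh h0.
transitivity (\int[lebesgue_measure \x lebesgue_tuple n]_p
    h [tuple of p.1 :: p.2]).
  have := ge0_integral_pushforward (@measurable_tuple_cons n)
    (lebesgue_measure \x lebesgue_tuple n) measurableT mh (fun t _ => h0 t).
  move=> <-; apply: eq_measure_integral => //.
  exact: measurable_tuple_cons.
rewrite fubini_tonelli1//.
exact: measurableT_comp (@measurable_tuple_cons n).
Qed.

Lemma ge0_integral_lebesgue_tuple0 (h : 0.-tuple R -> \bar R) :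
  measurable_fun [set: 0.-tuple R] h ->
  \int[lebesgue_tuple 0]_t h t = h [tuple].
Proof.
by move=> mh; rewrite [LHS]integral_dirac// diracT mul1e.
Qed.

Lemma measurable_tuple_map n (f : R -> R) : measurable_fun [set: R] f ->
  measurable_fun [set: n.-tuple R] (map_tuple f : n.-tuple R -> n.-tuple R).
Proof.
move=> mf; apply/measurable_fun_tnthP => i.
rewrite (_ : _ \o _ = f \o (fun t => tnth t i)).
  by apply: measurableT_comp => //; exact: measurable_tnth.
by apply/funext => t /=; rewrite tnth_map.
Qed.

Lemma measurable_prod_tnth n (k : 'I_n -> R -> R) :
  (forall i, measurable_fun [set: R] (k i)) ->
  measurable_fun [set: n.-tuple R] (fun t => \prod_(i < n) k i (tnth t i))%R.
Proof.
move=> mk; apply: measurable_prod => i _.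
by apply: measurableT_comp => //; exact: measurable_tnth.
Qed.

Definition pos_orthant n : set (n.-tuple R) :=
  [set u | forall i, (0 < tnth u i)%R].

Lemma measurable_pos_orthant n : measurable (@pos_orthant n).
Proof.
have := @measurable_box R n (fun=> `]0%R, +oo[%classic) (fun=> measurable_itv _).
congr (measurable _); apply/seteqP; split => u /= u0 i.
  by have := u0 i; rewrite in_itv/= andbT.
by rewrite in_itv/= andbT.
Qed.

(** Integrate the first coordinate last: the induction hypothesis applies to the
    inner integral, in which the first coordinate is a fixed positive number,
    and the one-dimensional change of variables to the outer one. *)
Lemma ge0_integral_map_expR n (h : n.-tuple R -> \bar R) :
  measurable_fun [set: n.-tuple R] h -> (forall t, 0 <= h t) ->
  \int[lebesgue_tuple n]_(u in @pos_orthant n) h u =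
  \int[lebesgue_tuple n]_t
    (h (map_tuple expR t) * (\prod_(i < n) expR (tnth t i))%:E).
Proof.
have mmap m : measurable_fun [set: m.-tuple R]
    (map_tuple expR : m.-tuple R -> m.-tuple R).
  exact: (measurable_tuple_map (@measurable_expR R)).
have mexp m : measurable_fun [set: m.-tuple R]
    (fun t => (\prod_(i < m) expR (tnth t i))%:E).
  apply/measurable_EFinP; apply: (@measurable_prod_tnth _ (fun=> expR)) => i.
  exact: measurable_expR.
have mgexp m (g : m.-tuple R -> \bar R) : measurable_fun [set: m.-tuple R] g ->
    measurable_fun [set: m.-tuple R]
      (fun t => g (map_tuple expR t) * (\prod_(i < m) expR (tnth t i))%:E).
  move=> mg; apply: emeasurable_funM; last exact: mexp.
  exact: (measurableT_comp mg (mmap m)).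
have exp0 m (t : m.-tuple R) : 0 <= (\prod_(i < m) expR (tnth t i))%:E.
  by rewrite lee_fin; apply: prodr_ge0 => i _; exact: expR_ge0.
elim: n h => [|n IHn] h mh h0.
  rewrite (_ : @pos_orthant 0 = setT); last by apply/seteqP; split => // u _ [].
  rewrite !ge0_integral_lebesgue_tuple0//.
    by rewrite big_ord0 mule1; congr h; exact: val_inj.
  exact: mgexp.
have mcons x : measurable_fun [set: n.-tuple R] (fun t => h [tuple of x :: t]).
  apply: (measurableT_comp mh).
  exact: (@measurable_cons _ _ _ _ (fun=> x) n id).
pose H x := \int[lebesgue_tuple n]_t
  (h [tuple of x :: map_tuple expR t] * (\prod_(i < n) expR (tnth t i))%:E).
have H0 x : 0 <= H x.
  by apply: integral_ge0 => t _; exact: mule_ge0.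
have mH : measurable_fun [set: R] H.
  apply: (@measurable_fun_fubini_tonelli_F _ _ _ _ _ (lebesgue_tuple n)
    (fun p => h [tuple of p.1 :: map_tuple expR p.2] *
      (\prod_(i < n) expR (tnth p.2 i))%:E)).
    apply: emeasurable_funM; last first.
      exact: (measurableT_comp (mexp n) measurable_snd).
    apply: (measurableT_comp mh); apply: measurable_cons.
      exact: measurable_fst.
    exact: (measurableT_comp (mmap n) measurable_snd).
  by move=> p; exact: mule_ge0.
have -> : \int[lebesgue_tuple n.+1]_(u in @pos_orthant n.+1) h u =
    \int[lebesgue_measure]_(x in `]0%R, +oo[) H x.
  rewrite integral_mkcond ge0_integral_lebesgue_tupleS; last 2 first.
  - apply/(measurable_restrictT h (@measurable_pos_orthant n.+1)).
    exact: measurable_funTS.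
  - by move=> t; apply: erestrict_ge0 => *.
  rewrite [RHS]integral_mkcond; apply: eq_integral => x _.
  rewrite patchE; case: ifPn => [|x0].
    rewrite inE/= in_itv/= andbT => x0.
    rewrite /H -(IHn (fun t => h [tuple of x :: t]))// [RHS]integral_mkcond.
    apply: eq_integral => t _; rewrite !patchE; congr (if _ then _ else _).
    apply/idP/idP; rewrite !inE/= => t0 i.
      by have := t0 (lift ord0 i); rewrite tnthS.
    by have [j ->|->] := unliftP ord0 i; rewrite ?tnthS ?tnth0.
  apply: integral0_eq => t _; rewrite patchE ifF//.
  apply/negbTE; apply: contra x0; rewrite !inE/= in_itv/= andbT => /(_ ord0).
  by rewrite tnth0.
rewrite ge0_integral_expR// ge0_integral_lebesgue_tupleS; last 2 first.
- exact: mgexp.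
- by move=> t; exact: mule_ge0.
apply: eq_integral => x _; rewrite /H -ge0_integralZr//; last 2 first.
- exact: (mgexp n (fun t => h [tuple of expR x :: t]) (mcons (expR x))).
- by move=> t _; exact: mule_ge0.
apply: eq_integral => t _; rewrite -muleA -EFinM big_ord_recl tnth0 mulrC.
congr (h _ * (_ * _)%:E); first exact: val_inj.
by apply: eq_bigr => i _; rewrite tnthS.
Qed.

Lemma ge0_integral_prod_tnth n (k : 'I_n -> R -> R) :
  (forall i, measurable_fun [set: R] (k i)) -> (forall i x, (0 <= k i x)%R) ->
  \int[lebesgue_tuple n]_t (\prod_(i < n) k i (tnth t i))%:E =
  \prod_(i < n) \int[lebesgue_measure]_x (k i x)%:E.
Proof.
elim: n k => [|n IHn] k mk k0.
  rewrite ge0_integral_lebesgue_tuple0 ?big_ord0//.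
  apply/measurable_EFinP; exact: (measurable_prod_tnth mk).
rewrite ge0_integral_lebesgue_tupleS; last 2 first.
- apply/measurable_EFinP; exact: (measurable_prod_tnth mk).
- by move=> t; rewrite lee_fin prodr_ge0.
rewrite big_ord_recl -IHn// -ge0_integralZr//; last 3 first.
- have : measurable_fun [set: R] (EFin \o k ord0) by exact/measurable_EFinP.
  exact.
- by move=> x _; rewrite lee_fin.
- by apply: integral_ge0 => t _; rewrite lee_fin prodr_ge0.
apply: eq_integral => x _; rewrite -ge0_integralZl//; last 3 first.
- apply/measurable_EFinP; exact: (measurable_prod_tnth (fun i => mk (lift ord0 i))).
- by move=> t _; rewrite lee_fin prodr_ge0.
- by rewrite lee_fin.
apply: eq_integral => t _; rewrite -EFinM big_ord_recl tnth0.
by congr (_ * _)%:E; apply: eq_bigr => i _; rewrite tnthS.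
Qed.

End lebesgue_tuple_integral.

(** * Adding an integrable function *)

Section integral_plus_integrable.
Context d (T : measurableType d) (R : realType).
Variable mu : {measure set T -> \bar R}.
Implicit Types f g : T -> R.
Local Open Scope ereal_scope.

Lemma le_integral_funeposD f g :
  measurable_fun [set: T] f -> measurable_fun [set: T] g ->
  \int[mu]_x (EFin \o (f \+ g)%R)^\+ x <=
  \int[mu]_x (EFin \o f)^\+ x + \int[mu]_x `|(g x)%:E|.
Proof.
move=> mf mg.
have mg' : measurable_fun [set: T] (fun x => `|(g x)%:E|).
  by apply: measurableT_comp => //; exact/measurable_EFinP.
have mf' : measurable_fun [set: T] (EFin \o f)^\+.
  by apply: measurable_funepos; exact/measurable_EFinP.
rewrite -ge0_integralD//; apply: ge0_le_integral => //.
- apply: measurable_funepos; apply/measurable_EFinP; exact: measurable_funD.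
- exact: emeasurable_funD.
move=> x _; rewrite !funeposE /= -!EFin_max -EFinD lee_fin ge_max; apply/andP; split.
  by rewrite lerD// ?le_max ?lexx ?ler_norm.
by rewrite addr_ge0// le_max lexx orbT.
Qed.

(** An integral is the difference of the integrals of the positive and negative
    parts, and oo - oo evaluates to -oo.  Adding an integrable g changes neither
    the finiteness of the positive part nor that of the negative part, so when
    f is not integrable both sides take the same infinite value. *)
Lemma integralD_integrabler f g :
  measurable_fun [set: T] f -> mu.-integrable [set: T] (EFin \o g) ->
  \int[mu]_x (f x + g x)%:E = \int[mu]_x (f x)%:E + \int[mu]_x (g x)%:E.
Proof.
move=> mf ig; have mg : measurable_fun [set: T] g.
  by apply/measurable_EFinP; exact: measurable_int ig.
have gfin : \int[mu]_x (g x)%:E \is a fin_num by exact: integrable_fin_num.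
have [_ goo] := integrableP _ _ _ ig.
set c := \int[mu]_x `|(g x)%:E| in goo.
have cN : \int[mu]_x `|((- g)%R x)%:E| = c.
  by apply: eq_integral => x _; rewrite /= normrN.
have mfg : measurable_fun [set: T] (f \+ g)%R by exact: measurable_funD.
have mNg : measurable_fun [set: T] (- g)%R by exact: measurableT_comp.
have mNf : measurable_fun [set: T] (- f)%R by exact: measurableT_comp.
have mNfg : measurable_fun [set: T] (- (f \+ g))%R by exact: measurableT_comp.
have le_pos := le_integral_funeposD mf mg.
have le_pos' : \int[mu]_x (EFin \o f)^\+ x <=
    \int[mu]_x (EFin \o (f \+ g)%R)^\+ x + c.
  have := le_integral_funeposD mfg mNg.
  rewrite cN (_ : ((f \+ g) \+ - g)%R = f)//.
  by apply/funext => x /=; rewrite addrK.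
have posN h : (EFin \o h)^\- = (EFin \o (- h)%R)^\+.
  by rewrite -funeposN.
have le_neg : \int[mu]_x (EFin \o (f \+ g)%R)^\- x <=
    \int[mu]_x (EFin \o f)^\- x + c.
  have := le_integral_funeposD mNf mNg.
  rewrite !posN cN (_ : ((- f) \+ (- g))%R = (- (f \+ g))%R)//.
  by apply/funext => x /=; rewrite [RHS]opprD.
have le_neg' : \int[mu]_x (EFin \o f)^\- x <=
    \int[mu]_x (EFin \o (f \+ g)%R)^\- x + c.
  have := le_integral_funeposD mNfg mg.
  rewrite !posN (_ : ((- (f \+ g)) \+ g)%R = (- f)%R)//.
  by apply/funext => x /=; rewrite [X in (X + _)%R]opprD subrK.
have [if_|if_] := pselect (mu.-integrable [set: T] (EFin \o f)).
  exact: integralD_EFin.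
have foo : \int[mu]_x (EFin \o f)^\+ x + \int[mu]_x (EFin \o f)^\- x = +oo.
  apply/eqP; rewrite -leye_eq leNgt; apply/negP => flt; apply: if_.
  apply/integrableP; split; first exact/measurable_EFinP.
  rewrite (_ : (fun x => _) = (EFin \o f)^\+ \+ (EFin \o f)^\-); last first.
    by rewrite -fune_abse.
  by rewrite ge0_integralD//;
    [exact/measurable_funepos/measurable_EFinP
    |exact/measurable_funeneg/measurable_EFinP].
have pos0 h : 0 <= \int[mu]_x (EFin \o h)^\+ x by exact: integral_ge0.
have neg0 h : 0 <= \int[mu]_x (EFin \o h)^\- x by exact: integral_ge0.
rewrite [LHS]integralE [in RHS](integralE _ _ (EFin \o f)).
rewrite -[X in X - _ = _]/(\int[mu]_x (EFin \o (f \+ g)%R)^\+ x).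
rewrite -[X in _ - X = _]/(\int[mu]_x (EFin \o (f \+ g)%R)^\- x).
move: (pos0 f) (neg0 f) (pos0 (f \+ g)%R) (neg0 (f \+ g)%R).
move: le_pos le_pos' le_neg le_neg' foo gfin goo.
case: (\int[mu]_x (EFin \o f)^\+ x) => [a| |]//;
case: (\int[mu]_x (EFin \o f)^\- x) => [b| |]//;
case: (\int[mu]_x (EFin \o (f \+ g)%R)^\+ x) => [a'| |]//;
case: (\int[mu]_x (EFin \o (f \+ g)%R)^\- x) => [b'| |]//;
by case: c {cN} => [r| |]//; case: (\int[mu]_x (g x)%:E).
Qed.

End integral_plus_integrable.

(** * Random vectors with a density *)

Section density_facts.
Context (R : realType) (d : measure_display) (T : measurableType d)
  (P : probability T R) (n : nat).
Local Open Scope charge_scope.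
Implicit Types (X U W : {RV P >-> n.-tuple R}) (f : n.-tuple R -> R).

Lemma ge0_integral_has_density X f (h : n.-tuple R -> \bar R) :
  has_density P X f -> measurable_fun [set: n.-tuple R] h ->
  (forall x, 0 <= h x)%E ->
  (\int[P]_w h (X w) = \int[lebesgue_tuple n]_x (h x * (f x)%:E))%E.
Proof.
move=> [mf f0 Xf] mh h0.
rewrite -(ge0_integral_density mf f0 (nu := distribution P X))//.
by rewrite ge0_integral_distribution.
Qed.

Lemma ae_distribution X (Q : n.-tuple R -> Prop) :
  {ae distribution P X, forall x, Q x} -> {ae P, forall w, Q (X w)}.
Proof.
move=> [N [mN N0 QN]]; exists (X @^-1` N); split => //.
- by rewrite -[X in measurable X]setTI; exact: measurable_funP.
- by move=> w /= Qw; exact: QN.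
Qed.

Lemma has_density_gt0 X f : has_density P X f ->
  {ae P, forall w, 0 < f (X w)}.
Proof.
move=> [mf f0 Xf]; apply: (@ae_distribution X (fun x => 0 < f x)).
exists (f @^-1` `]-oo, 0]); split.
- by rewrite -[X in measurable X]setTI; exact: mf.
- rewrite Xf; last by rewrite -[X in measurable X]setTI; exact: mf.
  apply: integral0_eq => x /=; rewrite in_itv/= => fx0.
  by congr EFin; apply/eqP; rewrite eq_le fx0 f0.
- by move=> x /=; rewrite in_itv/= leNgt => /negP.
Qed.

Let dominated X f : has_density P X f ->
  charge_of_finite_measure (distribution P X) `<< lebesgue_tuple n.
Proof.
move=> [mf f0 Xf]; apply/null_content_dominatesP => A mA A0.
transitivity (distribution P X A) => //; rewrite Xf// null_set_integral//.
by apply/measurable_EFinP; exact: measurable_funTS.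
Qed.

Lemma measurable_density X f : has_density P X f ->
  measurable_fun [set: n.-tuple R] (density P X).
Proof.
move=> hf; apply: measurableT_comp => //.
apply: measurable_int; apply: Radon_Nikodym_integrable; exact: dominated hf.
Qed.

(** A Radon-Nikodym derivative and f have the same integral on every measurable
    set, hence agree almost everywhere for the Lebesgue measure, hence for the
    law of X, which is absolutely continuous. *)
Lemma ae_density X f : has_density P X f ->
  {ae P, forall w, density P X (X w) = f (X w)}.
Proof.
move=> hf; have [mf f0 Xf] := hf; have dom := dominated hf.
have : ae_eq (lebesgue_tuple n) setT
    ('d (charge_of_finite_measure (distribution P X)) '/d (lebesgue_tuple n))
    (EFin \o f).
  apply: integral_ae_eq => //.
  - exact: Radon_Nikodym_integrable.
  - exact/measurable_EFinP.
  - by move=> E _ mE; rewrite -Radon_Nikodym_integral// -Xf.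
move=> /(null_dominates_ae_eq measurableT dom) => fE.
apply: (@ae_distribution X (fun x => density P X x = f x)).
by apply: filterS fE => x /(_ I); rewrite /density => ->.
Qed.

Lemma entropyE X f : has_density P X f ->
  (entropy P X = - 'E_P[fun w => ln (f (X w))])%E.
Proof.
move=> hf; have [mf _ _] := hf; rewrite /entropy unlock; congr (- _)%E.
have mlnX (g : n.-tuple R -> R) : measurable_fun [set: n.-tuple R] g ->
    measurable_fun [set: T] (fun w => (ln (g (X w)))%:E).
  move=> mg; apply/measurable_EFinP; apply: measurableT_comp => //.
  by apply: (measurableT_comp mg); exact: measurable_funPT.
apply: ae_eq_integral => //.
- exact: (mlnX _ (measurable_density hf)).
- exact: mlnX.
- by apply: filterS (ae_density hf) => w /= -> _.
Qed.

Lemma has_density_ae_eq X U f : {ae P, forall w, U w = X w} ->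
  has_density P X f -> has_density P U f.
Proof.
move=> [N [mN N0 UXN]] [mf f0 Xf]; split=> // A mA; rewrite -Xf//.
have mX : measurable (X @^-1` A).
  by rewrite -[X in measurable X]setTI; exact: measurable_funP.
have mU : measurable (U @^-1` A).
  by rewrite -[X in measurable X]setTI; exact: measurable_funP.
rewrite /distribution /pushforward -(measureU0 mU mN N0) -(measureU0 mX mN N0).
congr (P _); apply/seteqP; split=> w [/= Aw|Nw]; try by right.
- have [<-|UXw] := pselect (U w = X w); [by left|by right; exact: UXN].
- have [UXw|UXw] := pselect (U w = X w); [by left; rewrite /= UXw|].
  by right; exact: UXN.
Qed.

End density_facts.

(** * Density and entropy of the exponential of a random vector *)

Section expR_image.
Context (R : realType) (d : measure_display) (T : measurableType d)
  (P : probability T R) (n : nat).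
Implicit Types (X U W : {RV P >-> n.-tuple R}) (f : n.-tuple R -> R).

(** The Jacobian factor 1 / (u_1 ... u_n) is written exp (- sum of the ln u_i),
    to which it is equal on the positive orthant: this makes its measurability
    and its logarithm immediate. *)
Definition exp_pdf f : n.-tuple R -> R :=
  (fun u => f (map_tuple (@ln R) u) * expR (- \sum_(i < n) ln (tnth u i)))
    \_ (@pos_orthant R n).

Lemma map_expRK :
  cancel (map_tuple (@expR R)) (map_tuple (@ln R) : n.-tuple R -> _).
Proof. by move=> t; apply: eq_from_tnth => i; rewrite !tnth_map expRK. Qed.

Lemma exp_pdf_map_expR f t :
  exp_pdf f (map_tuple expR t) = f t * expR (- \sum_(i < n) tnth t i).
Proof.
rewrite /exp_pdf patchE ifT; last first.
  by rewrite inE => i; rewrite tnth_map expR_gt0.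
rewrite map_expRK; congr (_ * expR (- _)).
by apply: eq_bigr => i _; rewrite tnth_map expRK.
Qed.

Lemma has_density_expR W U f : has_density P W f ->
  {ae P, forall w, U w = map_tuple expR (W w)} -> has_density P U (exp_pdf f).
Proof.
move=> hf UW; have [mf f0 Wf] := hf.
have mexp : measurable_fun [set: n.-tuple R]
    (map_tuple expR : n.-tuple R -> n.-tuple R).
  exact: (measurable_tuple_map (@measurable_expR R)).
have mV : measurable_fun [set: T] (fun w => map_tuple expR (W w)).
  by apply: (measurableT_comp mexp); exact: measurable_funPT.
pose V : {RV P >-> n.-tuple R} :=
  HB.pack (fun w => map_tuple expR (W w)) (isMeasurableFun.Build _ _ _ _ _ mV).
have mg : measurable_fun [set: n.-tuple R] (exp_pdf f).
  apply/(measurable_restrictT _ (@measurable_pos_orthant R n)).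
  apply: measurable_funTS; apply: measurable_funM.
    apply: (measurableT_comp mf).
    exact: (measurable_tuple_map (@measurable_ln R)).
  apply: (measurableT_comp (@measurable_expR R)); apply: measurableT_comp => //.
  apply: measurable_sum => i; apply: (measurableT_comp (@measurable_ln R)).
  exact: measurable_tnth.
have g0 u : 0 <= exp_pdf f u.
  rewrite /exp_pdf patchE; case: ifPn => // _.
  by rewrite mulr_ge0// expR_ge0.
suff : has_density P V (exp_pdf f) by exact: has_density_ae_eq.
split=> // A mA.
have mEA : measurable (map_tuple expR @^-1` A).
  by rewrite -[X in measurable X]setTI; exact: mexp.
transitivity (distribution P W (map_tuple expR @^-1` A)) => //.
rewrite Wf// integral_mkcond.
transitivity (\int[lebesgue_tuple n]_(u in @pos_orthant R n)
   ((EFin \o exp_pdf f) \_ A) u)%E; last first.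
  rewrite [LHS]integral_mkcond [RHS]integral_mkcond; apply: eq_integral => u _.
  rewrite patchE; case: ifPn => // u0; rewrite patchE; case: ifPn => // _.
  by rewrite /= /exp_pdf patchE (negbTE u0).
rewrite ge0_integral_map_expR; last 2 first.
- by apply/(measurable_restrictT _ mA); exact/measurable_funTS/measurable_EFinP.
- by move=> u; apply: erestrict_ge0 => x _; rewrite lee_fin.
apply: eq_integral => t _; rewrite !patchE.
have -> : (t \in map_tuple expR @^-1` A) = (map_tuple expR t \in A).
  by apply/idP/idP; rewrite !inE.
case: ifPn => _; last by rewrite mul0e.
rewrite /= exp_pdf_map_expR -expR_sum -EFinM -mulrA -expRD.
by rewrite addNr expR0 mulr1.
Qed.

Lemma entropy_expR W U f : has_density P W f ->
  {ae P, forall w, U w = map_tuple expR (W w)} ->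
  (forall i, P.-integrable [set: T] (fun w => (tnth (W w) i)%:E)) ->
  (entropy P U = entropy P W + \sum_(i < n) 'E_P[fun w => tnth (W w) i])%E.
Proof.
move=> hf UW iW; have [mf f0 _] := hf.
have hg := has_density_expR hf UW; have [mg _ _] := hg.
have mlnf : measurable_fun [set: T] (fun w => ln (f (W w))).
  apply: measurableT_comp => //; apply: (measurableT_comp mf).
  exact: measurable_funPT.
have isum : P.-integrable [set: T] (EFin \o (fun w => \sum_(i < n) tnth (W w) i)).
  rewrite (_ : _ \o _ = fun w => \sum_(i < n) (tnth (W w) i)%:E)%E.
    exact: integrable_sum.
  by apply/funext => w /=; rewrite sumEFin.
have iN : P.-integrable [set: T] (EFin \o (fun w => - \sum_(i < n) tnth (W w) i)).
  exact: integrableN isum.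
rewrite (entropyE hg) (entropyE hf) !expectation.unlock.
transitivity (- \int[P]_w (ln (f (W w)) + - \sum_(i < n) tnth (W w) i)%:E)%E.
  congr (- _)%E; apply: ae_eq_integral => //.
  - apply/measurable_EFinP; apply: measurableT_comp => //.
    by apply: (measurableT_comp mg); exact: measurable_funPT.
  - apply/measurable_EFinP; apply: measurable_funD => //.
    exact/measurable_EFinP/(measurable_int _ iN).
  apply: filterS2 UW (has_density_gt0 hf) => w -> fW0 _; congr EFin.
  by rewrite exp_pdf_map_expR lnM ?posrE ?expR_gt0// expRK.
rewrite (integralD_integrabler mlnf iN).
rewrite oppeD; last first.
  by rewrite fin_num_adde_defl// integrable_fin_num.
congr (_ + _)%E.
rewrite -integralN; last exact: integrable_add_def.
rewrite -[RHS](integral_sum measurableT iW).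
by apply: eq_integral => w _; rewrite /= opprK sumEFin.
Qed.

End expR_image.

Lemma eq_expectation_has_density (R : realType) n (f h : n.-tuple R -> R)
  d (T : measurableType d) (P : probability T R) (X : {RV P >-> n.-tuple R})
  d' (T' : measurableType d') (P' : probability T' R)
  (X' : {RV P' >-> n.-tuple R}) :
  has_density P X f -> has_density P' X' f ->
  measurable_fun [set: n.-tuple R] h ->
  ('E_P[fun w => h (X w)] = 'E_P'[fun w => h (X' w)])%E.
Proof.
move=> Xf Xf' mh; rewrite !expectation.unlock [LHS]integralE [RHS]integralE.
have mhE : measurable_fun [set: n.-tuple R] (EFin \o h) by exact/measurable_EFinP.
have mp : measurable_fun [set: n.-tuple R] (EFin \o h)^\+%E.
  exact: measurable_funepos.
have mn : measurable_fun [set: n.-tuple R] (EFin \o h)^\-%E.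
  exact: measurable_funeneg.
congr (_ - _)%E.
- transitivity (\int[P]_w (EFin \o h)^\+ (X w))%E.
    by apply: eq_integral => w _; rewrite !funeposE.
  rewrite (ge0_integral_has_density Xf)// -(ge0_integral_has_density Xf')//.
  by apply: eq_integral => w _; rewrite !funeposE.
- transitivity (\int[P]_w (EFin \o h)^\- (X w))%E.
    by apply: eq_integral => w _; rewrite !funenegE.
  rewrite (ge0_integral_has_density Xf)// -(ge0_integral_has_density Xf')//.
  by apply: eq_integral => w _; rewrite !funenegE.
Qed.

(** * Quadratic forms and contractions *)

Section quadratic_forms.
Context (R : realType).

Definition sqn n (x : 'cV[R]_n) : R := \sum_i x i ord0 ^+ 2.

Definition dot n (x y : 'cV[R]_n) : R := \sum_i x i ord0 * y i ord0.

Lemma dotE n (x y : 'cV[R]_n) : dot x y = (x^T *m y) ord0 ord0.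
Proof. by rewrite mxE; apply: eq_bigr => i _; rewrite mxE. Qed.

Lemma dotC n (x y : 'cV[R]_n) : dot x y = dot y x.
Proof. by apply: eq_bigr => i _; rewrite mulrC. Qed.

Lemma dotDr n (x y z : 'cV[R]_n) : dot x (y + z) = dot x y + dot x z.
Proof. by rewrite !dotE mulmxDr mxE. Qed.

Lemma dotBl n (x y z : 'cV[R]_n) : dot (x - y) z = dot x z - dot y z.
Proof. by rewrite !dotE linearB/= mulmxBl !mxE. Qed.

Lemma dotxx n (x : 'cV[R]_n) : dot x x = sqn x.
Proof. by apply: eq_bigr => i _; rewrite expr2. Qed.

Lemma dot_adj n m (A : 'M[R]_(n, m)) (x : 'cV[R]_n) (y : 'cV[R]_m) :
  dot (A^T *m x) y = dot x (A *m y).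
Proof. by rewrite !dotE trmx_mul trmxK mulmxA. Qed.

Lemma sqn_ge0 n (x : 'cV[R]_n) : 0 <= sqn x.
Proof. by apply: sumr_ge0 => i _; exact: sqr_ge0. Qed.

Lemma sqn0 n : sqn (0 : 'cV[R]_n) = 0.
Proof. by apply: big1 => i _; rewrite mxE expr0n. Qed.

Lemma sqn_eq0 n (x : 'cV[R]_n) : sqn x = 0 -> x = 0.
Proof.
move=> /eqP; rewrite psumr_eq0; last by move=> i _; exact: sqr_ge0.
move=> /allP x0; apply/colP => i; rewrite mxE; apply/eqP.
by rewrite -sqrf_eq0; exact: x0 (mem_index_enum i).
Qed.

Lemma dot_le_half_sqnD n (x y : 'cV[R]_n) : dot x y <= (sqn x + sqn y) / 2.
Proof.
rewrite /dot /sqn -big_split/= mulr_suml; apply: ler_sum => i _.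
have := sqr_ge0 (x i ord0 - y i ord0); rewrite sqrrB.
by lra.
Qed.

Lemma sqn_mulmx_le n m (A : 'M[R]_(n, m)) :
  exists2 L : R, 0 < L & forall x, sqn (A *m x) <= L * sqn x.
Proof.
pose c i := (\sum_j `|A i j|) ^+ 2.
have c0 : 0 <= \sum_i c i by apply: sumr_ge0 => i _; exact: sqr_ge0.
exists (1 + \sum_i c i) => [|x]; first by rewrite ltr_pwDl.
suff : sqn (A *m x) <= (\sum_i c i) * sqn x.
  by move=> /le_trans; apply; rewrite ler_wpM2r ?sqn_ge0// lerDr.
rewrite mulr_suml; apply: ler_sum => i _.
rewrite -[sqn x]sqr_sqrtr ?sqn_ge0// -exprMn -real_normK ?num_real//.
rewrite lerXn2r ?nnegrE ?mulr_ge0 ?sqrtr_ge0 ?sumr_ge0//.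
rewrite mxE (le_trans (ler_norm_sum _ _ _))// mulr_suml; apply: ler_sum => j _.
rewrite normrM ler_wpM2l// -sqrtr_sqr ler_wsqrtr// /sqn.
by rewrite (bigD1 j)//= lerDl sumr_ge0// => k _; exact: sqr_ge0.
Qed.

Lemma unitmx_inj n (A : 'M[R]_n) :
  (forall x : 'cV[R]_n, A *m x = 0 -> x = 0) -> A \in unitmx.
Proof.
move=> A0; rewrite -unitmx_tr -row_free_unit; apply: inj_row_free => v vA.
apply: trmx_inj; rewrite trmx0; apply: A0.
by apply: trmx_inj; rewrite trmx_mul trmxK vA trmx0.
Qed.

Lemma posdefmx_unit n (A : 'M[R]_n) : posdefmx A -> A \in unitmx.
Proof.
move=> [_ Apos]; apply: unitmx_inj => x Ax0; apply/eqP/contraT => /Apos.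
by rewrite -mulmxA Ax0 mulmx0 mxE ltxx.
Qed.

Section contraction.
Variables (n m : nat) (D : 'M[R]_(n, m)).
Hypothesis hD : forall a : 'cV[R]_m, enorm a = 1 -> enorm (D *m a) < 1.

Lemma contraction_sqn_lt a : a != 0 -> sqn (D *m a) < sqn a.
Proof.
move=> a0; have sa0 : 0 < sqn a.
  by rewrite lt_neqAle sqn_ge0 andbT eq_sym; apply: contra a0 => /eqP/sqn_eq0 ->.
have sqnZ k p (x : 'cV[R]_p) : sqn (k *: x) = k ^+ 2 * sqn x.
  by rewrite mulr_sumr; apply: eq_bigr => i _; rewrite mxE exprMn.
pose k := (Num.sqrt (sqn a))^-1.
have k2 : k ^+ 2 = (sqn a)^-1 by rewrite exprVn sqr_sqrtr// sqn_ge0.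
have := hD (a := k *: a).
rewrite /enorm -!/(sqn _) -scalemxAr !sqnZ k2 mulVf ?gt_eqF// sqrtr1 => /(_ erefl).
rewrite -[X in _ < X]sqrtr1 ltr_sqrt// mulrC ltr_pdivrMr// mul1r; exact.
Qed.

Lemma contraction_sqn_le a : sqn (D *m a) <= sqn a.
Proof.
have [->|/contraction_sqn_lt/ltW//] := eqVneq a 0.
by rewrite mulmx0 sqn0 sqn_ge0.
Qed.

(** |D'u|^2 = <u, D D'u> <= (|u|^2 + |D D'u|^2) / 2 <= (|u|^2 + |D'u|^2) / 2. *)
Lemma contraction_tr_sqn_le u : sqn (D^T *m u) <= sqn u.
Proof.
have := dot_le_half_sqnD u (D *m (D^T *m u)).
rewrite -dot_adj dotxx; have := contraction_sqn_le (D^T *m u).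
by lra.
Qed.

Let S := 1%:M - D^T *m D.

Lemma contraction_unit : S \in unitmx.
Proof.
apply: unitmx_inj => x Sx; apply/eqP/contraT => /contraction_sqn_lt.
have xE : x = D^T *m (D *m x).
  by apply/eqP; rewrite -subr_eq0 -{1}[x]mul1mx mulmxA -mulmxBl -/S Sx.
have -> : sqn x = sqn (D *m x) by rewrite -(dotxx x) {2}xE dotC dot_adj dotxx.
by rewrite ltxx.
Qed.

(** With y = S^-1 t and u = D y one has y = t + D'u and D t = u - D D'u, whence
    <t, y> = |t|^2 + <D t, u> = |t|^2 + |u|^2 - |D'u|^2. *)
Lemma contraction_inv_ge t : sqn t <= dot t (invmx S *m t).
Proof.
pose y := invmx S *m t; pose u := D *m y; rewrite -/y.
have yE : y = t + D^T *m u.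
  have -> : t = S *m y by rewrite mulKVmx// contraction_unit.
  by rewrite mulmxBl mul1mx -mulmxA subrK.
have DtE : D *m t = u - D *m (D^T *m u).
  by rewrite -[t](addrK (D^T *m u)) -yE mulmxBr.
rewrite yE dotDr dotxx lerDl dotC dot_adj dotC DtE dotBl dotxx.
by rewrite dotC -dot_adj dotxx subr_ge0 contraction_tr_sqn_le.
Qed.

End contraction.
End quadratic_forms.

(** * Gaussian bounds *)

Section gaussian_integrals.
Context (R : realType).

Lemma integral_gauss_lty (c m : R) : 0 < c ->
  (\int[lebesgue_measure]_x (expR (- (c * (x - m) ^+ 2)))%:E < +oo)%E.
Proof.
(* the standard deviation for which 1 / (2 s^2) = c *)
move=> c0; pose s := Num.sqrt (2 * c)^-1.
have s0 : s != 0 by rewrite gt_eqF// sqrtr_gt0 invr_gt0 mulr_gt0.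
have s2 : (s ^+ 2 *+ 2)^-1 = c.
  rewrite sqr_sqrtr ?invr_ge0 ?mulr_ge0 1?ltW// -mulr_natr.
  by field; rewrite gt_eqF.
have peak0 := normal_peak_gt0 s0.
rewrite (_ : (fun x => _) =
    (fun x => (normal_peak s)^-1%:E * (normal_pdf m s x)%:E)%E); last first.
  apply/funext => x; rewrite normal_pdfE// -EFinM mulKf ?gt_eqF//.
  by rewrite /normal_fun s2 mulNr mulrC.
rewrite ge0_integralZl//=.
- by rewrite integral_normal_pdf mule1 ltry.
- by apply/measurable_EFinP; exact: measurable_normal_pdf.
- by move=> x _; rewrite lee_fin normal_pdf_ge0.
- by rewrite lee_fin invr_ge0 ltW.
Qed.

Lemma measurable_gauss (c m : R) :
  measurable_fun [set: R] (fun x => expR (- (c * (x - m) ^+ 2))).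
Proof.
apply: measurableT_comp => //; apply: measurableT_comp => //.
apply: measurable_funM => //; apply: measurable_funX.
exact: measurable_funB.
Qed.

Let gauss_prodE n (c : R) (m : 'cV[R]_n) (t : n.-tuple R) :
  expR (- (c * sqn (tcol t - m))) =
  \prod_(i < n) expR (- (c * (tnth t i - m i ord0) ^+ 2)).
Proof.
rewrite -expR_sum mulr_sumr -sumrN; congr expR; apply: eq_bigr => i _.
by rewrite !mxE.
Qed.

Lemma measurable_gauss_tuple n (c : R) (m : 'cV[R]_n) :
  measurable_fun [set: n.-tuple R] (fun t => expR (- (c * sqn (tcol t - m)))).
Proof.
under eq_fun do rewrite gauss_prodE.
apply: (@measurable_prod_tnth _ _ (fun i x => expR (- (c * (x - m i ord0) ^+ 2)))).
by move=> i; exact: measurable_gauss.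
Qed.

Lemma integral_gauss_tuple_lty n (c : R) (m : 'cV[R]_n) : 0 < c ->
  (\int[lebesgue_tuple n]_t (expR (- (c * sqn (tcol t - m))))%:E < +oo)%E.
Proof.
move=> c0; under eq_integral do rewrite gauss_prodE.
rewrite (ge0_integral_prod_tnth
  (k := fun i x => expR (- (c * (x - m i ord0) ^+ 2)))); last 2 first.
- by move=> i; exact: measurable_gauss.
- by move=> i x; exact: expR_ge0.
set p := (X in (X < _)%E); suff /andP[] : (0 <= p < +oo)%E by [].
rewrite {}/p; apply: (@big_ind _ (fun x => 0 <= x < +oo)%E) => [|x y|i _].
- by rewrite lee01 ltry.
- move=> /andP[x0 xoo] /andP[y0 yoo]; rewrite mule_ge0//=.
  by rewrite lte_mul_pinfty// ge0_fin_numE.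
rewrite integral_gauss_lty// andbT.
by apply: integral_ge0 => x _; rewrite lee_fin expR_ge0.
Qed.

Lemma measurable_mvnormal_pdf n (S : 'M[R]_n) :
  measurable_fun [set: n.-tuple R] (fun t => mvnormal_pdf S (tcol t)).
Proof.
apply: measurable_funM => //; apply: (measurableT_comp (@measurable_expR R)).
apply: measurable_funM => //; apply: measurableT_comp => //.
under eq_fun do rewrite mxE.
apply: measurable_sum => j; apply: measurable_funM; last first.
  under eq_fun do rewrite mxE.
  exact: measurable_tnth.
under eq_fun do rewrite mxE.
apply: measurable_sum => i; apply: measurable_funM => //.
under eq_fun do rewrite !mxE.
exact: measurable_tnth.
Qed.

Lemma mvnormal_pdf_ge0 n (S : 'M[R]_n) x : 0 <= mvnormal_pdf S x.
Proof. by rewrite mulr_ge0 ?expR_ge0// invr_ge0 sqrtr_ge0. Qed.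

Lemma mvnormal_cdf_ge0 n (S : 'M[R]_n) y : 0 <= mvnormal_cdf S y.
Proof.
apply: fine_ge0; apply: integral_ge0 => t _.
by rewrite lee_fin mvnormal_pdf_ge0.
Qed.

Lemma mvnormal_cdf_bounded n (S : 'M[R]_n) :
  (forall t, sqn t <= dot t (invmx S *m t)) ->
  exists2 C : R, 0 <= C & forall y, mvnormal_cdf S y <= C.
Proof.
move=> Sinv.
pose I := (\int[lebesgue_tuple n]_t (mvnormal_pdf S (tcol t))%:E)%E.
have I0 : (0 <= I)%E.
  by apply: integral_ge0 => t _; rewrite lee_fin mvnormal_pdf_ge0.
have mS : measurable_fun [set: n.-tuple R] (fun t => (mvnormal_pdf S (tcol t))%:E).
  by apply/measurable_EFinP; exact: measurable_mvnormal_pdf.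
have Ioo : (I < +oo)%E.
  pose K := (Num.sqrt ((2 * pi) ^+ n * \det S))^-1.
  have K0 : 0 <= K by rewrite invr_ge0 sqrtr_ge0.
  apply: (@le_lt_trans _ _ (K%:E *
    \int[lebesgue_tuple n]_t (expR (- (2^-1 * sqn (tcol t - 0))))%:E)%E).
    rewrite -ge0_integralZl//.
    - apply: ge0_le_integral => //.
      + by move=> t _; rewrite lee_fin mvnormal_pdf_ge0.
      + apply: emeasurable_funM => //.
        by apply/measurable_EFinP; exact: measurable_gauss_tuple.
      + move=> t _; rewrite -EFinM lee_fin ler_wpM2l// ler_expR subr0 mulNr lerN2.
        by rewrite mulrC ler_wpM2r// -mulmxA -dotE.
    - by apply/measurable_EFinP; exact: measurable_gauss_tuple.
  apply: lte_mul_pinfty => //.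
  by apply: integral_gauss_tuple_lty.
exists (fine I) => [|y]; first exact: fine_ge0.
have mY : measurable [set t : n.-tuple R | forall i, tnth t i <= y i ord0].
  have := @measurable_box R n (fun i => `]-oo, y i ord0]%classic)
    (fun=> measurable_itv _).
  congr (measurable _); apply/seteqP; split => t /= ty i;
    by have := ty i; rewrite in_itv.
rewrite /mvnormal_cdf /Rintegral fine_le//.
- rewrite ge0_fin_numE; last first.
    by apply: integral_ge0 => t _; rewrite lee_fin mvnormal_pdf_ge0.
  apply: le_lt_trans Ioo; apply: ge0_subset_integral => //.
  by move=> t _; rewrite lee_fin mvnormal_pdf_ge0.
- by rewrite ge0_fin_numE.
- apply: ge0_subset_integral => //.
  by move=> t _; rewrite lee_fin mvnormal_pdf_ge0.
Qed.

End gaussian_integrals.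

Section cfusn_moments.
Context (R : realType) (n m : nat).
Variables (mu : 'cV[R]_n) (Sigma Sh : 'M[R]_n) (Delta : 'M[R]_(n, m)).
Hypothesis hSh : posdefmx Sh.
Hypothesis hDelta : forall a : 'cV[R]_m, enorm a = 1 -> enorm (Delta *m a) < 1.

(** The distribution function in the density is bounded, and w - mu = Sh z
    bounds |w - mu|^2 by a multiple of |z|^2 in the Gaussian factor. *)
Lemma cfusn_pdf_le_gauss : exists2 K : R, 0 <= K & exists2 c : R, 0 < c &
  forall w, cfusn_pdf mu Sigma Sh Delta w <= K * expR (- (c * sqn (tcol w - mu))).
Proof.
have [C C0 cdfC] := mvnormal_cdf_bounded (contraction_inv_ge hDelta).
have [L L0 hL] := sqn_mulmx_le Sh.
pose K := 2 ^+ m * (Num.sqrt (\det Sigma))^-1 *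
  (Num.sqrt ((2 * pi) ^+ n * \det (1%:M : 'M[R]_n)))^-1 * C.
have K0 : 0 <= K.
  by rewrite !mulr_ge0 ?invr_ge0 ?sqrtr_ge0 ?exprn_ge0.
exists K => //; exists (2 * L)^-1; first by rewrite invr_gt0 mulr_gt0.
move=> w; rewrite /cfusn_pdf; set z := invmx Sh *m (tcol w - mu).
have -> : tcol w - mu = Sh *m z by rewrite mulKVmx// posdefmx_unit.
rewrite /K -!mulrA ler_wpM2l ?exprn_ge0// ler_wpM2l ?invr_ge0 ?sqrtr_ge0//.
rewrite ler_wpM2l ?invr_ge0 ?sqrtr_ge0//.
rewrite mulrC ler_pM ?expR_ge0 ?mvnormal_cdf_ge0// ler_expR invmx1 mulmx1.
rewrite -dotE dotxx mulNr lerN2 mulrC ler_pdivrMr ?mulr_gt0//.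
by rewrite (_ : sqn z / 2 * (2 * L) = L * sqn z)//; field.
Qed.

(** |w_i| grows more slowly than exp (c |w - mu|^2 / 2), so multiplying the
    Gaussian bound of the density by |w_i| only halves the rate of decay. *)
Lemma integrable_cfusn d (T : measurableType d) (P : probability T R)
    (W : {RV P >-> n.-tuple R}) : cfusn P W mu Sigma Sh Delta ->
  forall i, P.-integrable [set: T] (fun w => (tnth (W w) i)%:E).
Proof.
move=> hW i; have [mf f0 _] := hW.
have [K K0 [c c0 hK]] := cfusn_pdf_le_gauss.
set f := cfusn_pdf mu Sigma Sh Delta in hW mf f0 hK.
have mi : measurable_fun [set: n.-tuple R] (fun t => (tnth t i)%:E).
  by apply/measurable_EFinP; exact: measurable_tnth.
have mabs : measurable_fun [set: n.-tuple R] (fun t => `|(tnth t i)%:E|)%E.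
  exact: measurableT_comp.
apply/integrableP; split.
  by apply: (measurableT_comp mi); exact: measurable_funPT.
rewrite (ge0_integral_has_density hW (h := fun t => `|(tnth t i)%:E|%E))//.
(* |w_i| <= |mu_i| + 1 + q and q = (2 / c) (c q / 2), where q = |w - mu|^2; so
   |w_i| <= B (1 + c q / 2) <= B exp (c q / 2). *)
pose B := `|mu i ord0| + 1 + 2 / c.
have B0 : 0 <= B by rewrite !addr_ge0// divr_ge0// ltW.
have le_gauss t : `|tnth t i| * f t <=
    B * K * expR (- (c / 2 * sqn (tcol t - mu))).
  set q := sqn (tcol t - mu).
  have q0 : 0 <= q := sqn_ge0 _.
  have tiB : `|tnth t i| <= B * expR (c / 2 * q).
    pose y := tnth t i - mu i ord0.
    have y2 : y ^+ 2 <= q.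
      rewrite /q /sqn (bigD1 i)//= !mxE lerDl sumr_ge0// => j _.
      exact: sqr_ge0.
    have yy : `|y| <= 1 + y ^+ 2.
      rewrite -[y ^+ 2]real_normK ?num_real//.
      by have := sqr_ge0 (`|y| - 2^-1); nra.
    have tmy : `|tnth t i| <= `|mu i ord0| + `|y|.
      by rewrite -{1}[tnth t i](subrK (mu i ord0)) addrC ler_normD.
    apply: (@le_trans _ _ (B * (1 + c / 2 * q))); last first.
      by rewrite ler_wpM2l// expR_ge1Dx.
    have -> : B * (1 + c / 2 * q) =
        `|mu i ord0| + 1 + 2 / c + (`|mu i ord0| + 1) * (c / 2 * q) + q.
      by rewrite /B; field; rewrite gt_eqF.
    have : 0 <= 2 / c by rewrite divr_ge0// ltW.
    have : 0 <= (`|mu i ord0| + 1) * (c / 2 * q).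
      by rewrite mulr_ge0 ?addr_ge0 ?mulr_ge0// ltW// divr_gt0.
    lra.
  have -> : - (c / 2 * q) = c / 2 * q + - (c * q) by field.
  by rewrite expRD mulrACA ler_pM.
apply: (@le_lt_trans _ _ ((B * K)%:E *
   \int[lebesgue_tuple n]_t (expR (- (c / 2 * sqn (tcol t - mu))))%:E)%E).
  rewrite -ge0_integralZl//.
  - apply: ge0_le_integral => //.
    + by move=> t _; rewrite mule_ge0// lee_fin.
    + by apply: emeasurable_funM => //; exact/measurable_EFinP.
    + apply: emeasurable_funM => //.
      by apply/measurable_EFinP; exact: measurable_gauss_tuple.
    + by move=> t _; rewrite -EFinM lee_fin.
  - by apply/measurable_EFinP; exact: measurable_gauss_tuple.
  - by rewrite lee_fin mulr_ge0.
apply: lte_mul_pinfty => //; first by rewrite lee_fin mulr_ge0.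
by apply: integral_gauss_tuple_lty; rewrite divr_gt0.
Qed.

End cfusn_moments.

Theorem proposition3 (R : realType) (n m : nat) (hn : (0 < n)%N) (hm : (0 < m)%N)
    (mu : 'cV[R]_n) (Sigma Sh : 'M[R]_n) (Delta : 'M[R]_(n, m))
    (hSigma : posdefmx Sigma)
    (hSh : posdefmx Sh) (hSh2 : Sh *m Sh = Sigma)
    (hDelta : forall a : 'cV[R]_m, enorm a = 1 -> enorm (Delta *m a) < 1)
    (d : measure_display) (T : measurableType d) (P : probability T R)
    (Z : {RV P >-> n.-tuple R}) (hZ : lcfusn P Z mu Sigma Sh Delta)
    (d' : measure_display) (T' : measurableType d') (P' : probability T' R)
    (X : {RV P' >-> n.-tuple R}) (hX : cfusn P' X mu Sigma Sh Delta) :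
  entropy P Z = (entropy P' X + \sum_(i < n) 'E_P'[fun w => tnth (X w) i])%E.
Proof.
have [W [hW ZW]] := hZ; have [mf _ _] := hX.
rewrite (entropy_expR hW ZW (integrable_cfusn hSh hDelta hW)).
congr (_ + _)%E; last first.
  apply: eq_bigr => i _.
  apply: (eq_expectation_has_density (h := fun t => tnth t i) hW hX).
  exact: measurable_tnth.
rewrite (entropyE hW) (entropyE hX); congr (- _)%E.
apply: (eq_expectation_has_density
  (h := fun t => ln (cfusn_pdf mu Sigma Sh Delta t)) hW hX).
exact: (measurableT_comp (@measurable_ln R) mf).
Qed.
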